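(* Let $J$ be a finite set with $m:=|J|\ge 3$, let $\Pi=(P_x)_{x\in J}$ be a partition of a finite set $P$ of participants, let $\mathcal{Z}=(J,h,\boldsymbol g)$ be a uniform polymatroid with increment sequence $\boldsymbol g=(g_i)_{0\le i\le m}$ and $0<g_0<|P_x|$ for all $x\in J$, let $\Delta\subseteq\mathcal{P}(J)\setminus\{\emptyset\}$ be a monotone increasing family compatible with $\mathcal{Z}$, and let $\Gamma=\Gamma(\Pi,\mathcal{Z},\Delta)$. If $g_1>g_{m-1}>0$ and $\min\Delta\neq\{\{x\}\}$ for every $x\in J$, then the access structure $\Gamma$ is compartmented.
   Context: Polymatroids. For a finite set $J$ let $\mathcal{P}(J)$ be its power set. An (integer) polymatroid is a pair $(J,h)$ with $h:\mathcal{P}(J)\to\mathbb{N}_0$ such that $h(\emptyset)=0$, $h(X)\le h(Y)$ if $X\subseteq Y$, and $h(X\cap Y)+h(X\cup Y)\le h(X)+h(Y)$. It is uniform if $h(X)=h(Y)$ whenever $|X|=|Y|$; write $h_i=h(X)$ for $|X|=i$. With $m=|J|$, its increment sequence is $\boldsymbol g=(g_0,\dots,g_m)$, $g_i=h_{i+1}-h_i$ for $0\le i\le m-1$ and $g_m=0$; it is a nonincreasing sequence of nonnegative integers, and $g_0>0$ is assumed. Such a polymatroid is written $\mathcal{Z}=(J,h,\boldsymbol g)$. Compatibility. A monotone increasing family $\Delta\subseteq\mathcal{P}(J)\setminus\{\emptyset\}$ is a nonempty family of nonempty subsets of $J$ closed under taking supersets in $J$; $\min\Delta$ is the set of its inclusion-minimal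 members. Fix $x_0\notin J$ and define $h'$ on $\mathcal{P}(J\cup\{x_0\})$ by $h'(X)=h(X)$ for $X\subseteq J$, $h'(X\cup\{x_0\})=h(X)$ if $X\in\Delta$, and $h'(X\cup\{x_0\})=h(X)+1$ if $X\subseteq J$, $X\notin\Delta$. $\Delta$ is compatible with $\mathcal{Z}$ if $h'$ is monotone increasing and submodular. Access structure. A partition $\Pi=(P_x)_{x\in J}$ of $P$ consists of pairwise disjoint nonempty sets (blocks) with union $P$. For $A\subseteq P$ put $\pi(A)=(|A\cap P_x|)_{x\in J}\in\mathbb{N}_0^J$. For $\bar v\in\mathbb{N}_0^J$ and $Y\subseteq J$ put $\mathrm{supp}(\bar v)=\{x:v_x\ne0\}$, $|\bar v|=\sum_{x\in J}v_x$, $|\bar v_Y|=\sum_{x\in Y}v_x$. For $X\subseteq J$ let $\mathcal{B}(\mathcal{Z},X)=\{\bar v\in\mathbb{N}_0^J:\mathrm{supp}(\bar v)\subseteq X,\ |\bar v|=h(X),\ |\bar v_Y|\le h(Y)\text{ for all }Y\subseteq X\}$. Then $\Gamma(\Pi,\mathcal{Z},\Delta)$ is the family of all $A\subseteq P$ such that $\pi(A)\ge\bar v$ (coordinatewise) for some $\bar v\in\bigcup_{X\in\Delta}\mathcal{B}(\mathcal{Z},X)$. Hierarchy. For participants $p,q\in P$ write $q\preccurlyeq p$ if $A\cup\{p\}\in\Gamma$ for all $A\subseteq P\setminus\{p,q\}$ with $A\cup\{q\}\in\Gamma$. For blocks, $P_y\preccurlyeq P_x$ means $q\preccurlyeq p$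 for some (equivalently, all) $q\in P_y$, $p\in P_x$. Two blocks $P_x,P_y$ are hierarchically independent if neither $P_x\preccurlyeq P_y$ nor $P_y\preccurlyeq P_x$. $\Gamma$ is compartmented if every two different blocks of $\Pi$ are hierarchically independent. *)

(* Defs.v *)
From mathcomp Require Import all_boot.

Set Implicit Arguments.
Unset Strict Implicit.
Unset Printing Implicit Defensive.

Section SetFunctions.
Variable J : finType.
Implicit Types (h : {set J} -> nat) (X Y : {set J}).

Definition monotone_setfun h : Prop := forall X Y, X \subset Y -> h X <= h Y.

Definition submodular h : Prop :=
  forall X Y, h (X :&: Y) + h (X :|: Y) <= h X + h Y.

Definition polymatroid h : Prop :=
  [/\ h set0 = 0, monotone_setfun h & submodular h].

Definition uniform h : Prop := forall X Y, #|X| = #|Y| -> h X = h Y.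

(* Only g 0, ..., g #|J| are constrained.  The truncated subtraction is exact
   for uniform polymatroids, since then h X <= h Y whenever #|X| <= #|Y|. *)
Definition increment_sequence h (g : nat -> nat) : Prop :=
  (forall i X Y, i < #|J| -> #|X| = i -> #|Y| = i.+1 -> g i = h Y - h X)
  /\ g #|J| = 0.

Definition uniform_polymatroid h g : Prop :=
  [/\ polymatroid h, uniform h & increment_sequence h g].

End SetFunctions.

Section Compatibility.
Variable J : finType.
Implicit Types (h : {set J} -> nat) (Delta : {set {set J}}).

Definition monotone_family Delta : Prop :=
  [/\ Delta != set0, set0 \notin Delta
    & forall X Y : {set J}, X \in Delta -> X \subset Y -> Y \in Delta].

Definition min_family Delta : {set {set J}} :=
  [set X | minset (mem Delta) X].

(* The set J with an extra point x0 is [option J], with x0 = None. *)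
Definition extension h Delta (Z : {set option J}) : nat :=
  let X := [set x | Some x \in Z] in
  if (None \in Z) && (X \notin Delta) then h X + 1 else h X.

Definition compatible h Delta : Prop :=
  monotone_setfun (extension h Delta) /\ submodular (extension h Delta).

End Compatibility.

Section AccessStructure.
Variables J P : finType.
Implicit Types (Pi : J -> {set P}) (h : {set J} -> nat).
Implicit Types (v : {ffun J -> nat}) (X Y : {set J}) (A : {set P}).

Definition block_partition Pi : Prop :=
  [/\ forall x, Pi x != set0,
      forall x y, x != y -> [disjoint Pi x & Pi y]
    & \bigcup_x Pi x = [set: P]].

Definition profile Pi A : {ffun J -> nat} := [ffun x => #|A :&: Pi x|].

Definition supp v : {set J} := [set x | v x != 0].

Definition basis_vector h X v : Prop :=
  [/\ supp v \subset X, \sum_x v x = h X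
    & forall Y, Y \subset X -> \sum_(x in Y) v x <= h Y].

Definition access_structure Pi h (Delta : {set {set J}}) A : Prop :=
  exists v X, [/\ X \in Delta, basis_vector h X v
                & forall x, v x <= profile Pi A x].

End AccessStructure.

Section Hierarchy.
Variables J P : finType.
Implicit Types (Gamma : {set P} -> Prop) (Pi : J -> {set P}).

Definition participant_le Gamma (q p : P) : Prop :=
  forall A : {set P}, A \subset ~: [set p; q] ->
    Gamma (q |: A) -> Gamma (p |: A).

Definition block_le Gamma (B C : {set P}) : Prop :=
  exists q p, [/\ q \in B, p \in C & participant_le Gamma q p].

Definition hierarchically_independent Gamma (B C : {set P}) : Prop :=
  ~ block_le Gamma B C /\ ~ block_le Gamma C B.

Definition compartmented Pi Gamma : Prop :=
  forall x y : J, Pi x != Pi y ->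
    hierarchically_independent Gamma (Pi x) (Pi y).

End Hierarchy.

(* Main.v *)
(**
For blocks x <> y, take a basis vector v of some X in Delta with v y > 0 such
that v - e_y + e_x dominates no basis vector; u = v - e_y then refutes
P_y <= P_x.

If {x} is not in Delta, let g_1 = ... = g_j > g_(j+1).  Compatibility yields a
set Z0 of size j outside Delta with x in Z0 and y not in Z0; give x the value
g_0, y the value g_1, and put the values below g_1 outside Z0.  As v x = g_0 is
already maximal, the extra unit at x is useless, and a set of Delta can only be
served by v - e_y if it lies inside Z0.

If {x} is in Delta, another minimal set M exists and does not contain x.
Compatibility of {x} and M gives g_|M| < g_0, so on X = M + y a basis vector
with v y = g_0 leaves too little weight on M; a set Z of Delta that contains x
would need g_(|Z|-1) = 1, contradicting the compatibility of X and Z.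
*)

Require Import Defs.
From mathcomp Require Import all_boot.
From mathcomp Require Import zify.

Set Implicit Arguments.
Unset Strict Implicit.
Unset Printing Implicit Defensive.

Lemma setI_setU1 (T : finType) (X : {set T}) a b :
  a != b -> a \notin X -> b \notin X -> (a |: X) :&: (b |: X) = X.
Proof.
move=> ab aX bX; rewrite -setUIl; apply/setUidPr/subsetP => z.
by rewrite !inE => /andP[/eqP-> /idPn]; rewrite ab.
Qed.

Lemma setU_setU1 (T : finType) (X : {set T}) a b :
  (a |: X) :|: (b |: X) = b |: (a |: X).
Proof. by rewrite setUCA -setUA setUid. Qed.

(** * Ranks and increments of a uniform polymatroid *)

Section UniformPolymatroid.
Variables (J : finType) (h : {set J} -> nat) (g : nat -> nat).
Hypothesis hZ : uniform_polymatroid h g.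

Lemma rankD1 (X : {set J}) x : x \in X -> h X = h (X :\ x) + g #|X|.-1.
Proof.
move=> xX; case: hZ => -[_ hmono _] _ [hg _].
have cX : #|X| = #|X :\ x|.+1 by rewrite (cardsD1 x) xX.
have ltX : #|X :\ x| < #|J| by rewrite -cX max_card.
rewrite cX /= (hg _ (X :\ x) X ltX erefl cX) subnKC //.
exact/hmono/subD1set.
Qed.

Lemma rankU1 (X : {set J}) x : x \notin X -> h (x |: X) = h X + g #|X|.
Proof.
by move=> xX; rewrite (rankD1 (setU11 x X)) setU1K // cardsU1 xX add1n.
Qed.

Lemma rank1 x : h [set x] = g 0.
Proof.
case: hZ => -[h0 _ _] _ _.
by rewrite (rankD1 (set11 x)) setDv h0 cards1.
Qed.

(** Submodularity for two sets of size [i.+1] that share [i] elements. The second alternative is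
    there because [g] is unconstrained beyond [#|J|]. *)
Lemma incr_step i : g i.+1 <= g i \/ #|J| <= i.
Proof.
case: hZ => -[_ _ hsub] _ [_ gm].
have [ltiJ|] := ltnP i.+1 #|J|; last first.
  by rewrite leq_eqVlt => /orP[/eqP <-|]; [left; rewrite gm | right].
have /card_geqP[[|a [|b s]] [us ss _]] := ltiJ => //.
move: us ss => /=; rewrite inE negb_or -!andbA => /and4P[ab a_s b_s us] [ss]; left.
set X := [set:: s].
have cX : #|X| = i by rewrite cardsE (card_uniqP us).
have aX : a \notin X by rewrite inE.
have bX : b \notin X by rewrite inE.
have bXa : b \notin a |: X by rewrite !inE negb_or eq_sym ab.
have := hsub (a |: X) (b |: X).
rewrite setI_setU1 // setU_setU1 !rankU1 // cardsU1 aX cX add1n; lia.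
Qed.

Lemma incr_antitone i j : i <= j -> j <= #|J| -> g j <= g i.
Proof.
elim: j => [|j IH]; first by rewrite leqn0 => /eqP ->.
rewrite leq_eqVlt => /orP[/eqP -> //|ij jJ].
have [step|] := incr_step j; last by lia.
by apply: leq_trans step (IH _ _); lia.
Qed.

(** * Basis vectors: bounds and the greedy construction *)

Lemma basis_sum (X : {set J}) v :
  basis_vector h X v -> \sum_(z in X) v z = h X.
Proof.
case=> /subsetP sv <- _; rewrite big_mkcond /=; apply: eq_bigr => z _.
by case: ifPn => // zX; apply/esym/eqP; apply: contraNT zX => vz; apply: sv; rewrite inE.
Qed.

Lemma basis_sum_le (X Y : {set J}) v :
  basis_vector h X v -> Y \subset X -> \sum_(z in Y) v z <= h Y.
Proof. by move=> [_ _]; apply. Qed.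

(** The entries other than [z] weigh at most [h (X :\ z)], so [z] must supply the last increment. *)
Lemma basis_ge (X : {set J}) v z :
  basis_vector h X v -> z \in X -> g #|X|.-1 <= v z.
Proof.
move=> bv zX; have := basis_sum_le bv (subD1set X z).
have := basis_sum bv; rewrite (big_setD1 z) //= (rankD1 zX); lia.
Qed.

Lemma basis_le (X : {set J}) v z : basis_vector h X v -> v z <= g 0.
Proof.
move=> bv; have [zX|zX] := boolP (z \in X).
  by have := basis_sum_le bv (Y := [set z]); rewrite sub1set big_set1 rank1; apply.
case: bv => /subsetP sv _ _; case: (posnP (v z)) => [-> //|vz].
by rewrite sv ?inE -?lt0n in zX.
Qed.

(** The vertex that Edmonds' greedy algorithm produces for the order [s]. *)
Definition greedy (s : seq J) : {ffun J -> nat} :=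
  [ffun z => if z \in s then g (index z s) else 0].

Lemma greedy_sum_le s (Y : {set J}) : uniq s -> Y \subset s ->
  \sum_(z in Y) greedy s z <= h Y.
Proof.
elim/last_ind: s Y => [|s a IH] Y.
  by move=> _ /subsetP sY; rewrite big1 // => z /sY; rewrite in_nil.
rewrite rcons_uniq => /andP[as_ us] /subsetP sY.
have IHa : \sum_(z in Y :\ a) greedy (rcons s a) z <= h (Y :\ a).
  have sYa : Y :\ a \subset s.
    apply/subsetP => z; rewrite !inE => /andP[za /sY].
    by rewrite mem_rcons inE (negbTE za).
  apply: leq_trans (IH _ us sYa); apply: leq_sum => z /(subsetP sYa) zs.
  by rewrite !ffunE mem_rcons inE zs orbT -cats1 index_cat zs.
have [aY|aY] := boolP (a \in Y); last by move: IHa; rewrite (setDidPl _) // disjoint_sym disjoints1.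
rewrite (big_setD1 a) //= addnC (rankD1 aY) leq_add //.
rewrite ffunE mem_rcons mem_head -cats1 index_cat (negbTE as_) /= eqxx addn0.
(* The last entry receives [g (size s)], while it adds [g #|Y|.-1] to the rank of [Y]; the size
   bound makes the former the smaller increment. *)
have leY : #|Y| <= (size s).+1.
  have urs : uniq (rcons s a) by rewrite rcons_uniq as_.
  by rewrite -(size_rcons s a) -(card_uniqP urs); apply/subset_leq_card/subsetP.
have leJ : size s <= #|J| by rewrite -(card_uniqP us) max_card.
by apply: incr_antitone => //; case: #|Y| leY.
Qed.

Lemma greedy_sum s : uniq s -> \sum_z greedy s z = h [set:: s].
Proof.
have -> : \sum_z greedy s z = \sum_(z in s) greedy s z.
  rewrite [RHS]big_mkcond; apply: eq_bigr => z _.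
  by rewrite ffunE; case: (z \in s).
elim/last_ind: s => [_|s a IH].
  have -> : [set:: [::]] = set0 :> {set J} by apply/setP => z; rewrite !inE.
  by have [[-> _ _] _ _] := hZ; rewrite big_pred0.
rewrite rcons_uniq => /andP[as_ us].
have -> : [set:: rcons s a] = a |: [set:: s].
  by apply/setP => z; rewrite !inE mem_rcons inE.
rewrite rankU1 ?inE // -IH // cardsE (card_uniqP us).
rewrite -!big_uniq ?rcons_uniq ?as_ //= -cats1 big_cat big_seq1 /=; congr (_ + _).
  apply: eq_big_seq => z zs.
  by rewrite !ffunE mem_cat zs index_cat zs.
by rewrite ffunE mem_cat mem_head orbT index_cat (negbTE as_) /= eqxx addn0.
Qed.

Lemma greedy_basis s : uniq s -> basis_vector h [set:: s] (greedy s).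
Proof.
move=> us; split; last 1 first.
- move=> Y /subsetP sY; apply: greedy_sum_le => //.
  by apply/subsetP => z /sY; rewrite inE.
- by apply/subsetP => z; rewrite !inE ffunE; case: (z \in s).
- exact: greedy_sum.
Qed.

(** * Compatibility, and profiles separating two blocks *)

Section Ports.
Variable Delta : {set {set J}}.
Hypothesis hDelta : monotone_family Delta.
Hypothesis hcomp : compatible h Delta.
Hypothesis hgm : g (#|J| - 1) > 0.

(** Submodularity of the extension, with the extra point added to both sets: only the intersection
    pays the additional unit. All uses of compatibility go through this inequality. *)
Lemma compatible_strict (X Y : {set J}) : X \in Delta -> Y \in Delta ->
  X :&: Y \notin Delta -> h (X :&: Y) + h (X :|: Y) < h X + h Y.
Proof.
move=> XD YD XYD; case: hcomp => _ /(_ (None |: Some @: X) (None |: Some @: Y)).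
have pre (Z : {set J}) : [set z | Some z \in None |: Some @: Z] = Z.
  by apply/setP => z; rewrite !inE mem_imset //; apply: Some_inj.
rewrite -setUIr -imsetI; last by move=> ? ? _ _ [].
rewrite -setUUr -imsetU /extension !pre !setU11 /= XYD XD YD /=.
have -> : X :|: Y \in Delta by case: hDelta => _ _ /(_ _ _ XD); apply; apply: subsetUl.
by rewrite /= addn1 addSn.
Qed.

Lemma incr_gt0 i : i < #|J| -> 0 < g i.
Proof. by move=> iJ; apply: leq_trans hgm (incr_antitone _ _); lia. Qed.

Lemma incr_card_gt0 (X : {set J}) z : z \in X -> 0 < g #|X|.-1.
Proof.
move=> zX; apply: incr_gt0; apply: leq_trans (max_card X).
by rewrite prednK //; apply/card_gt0P; exists z.
Qed.

(* The profile [u] witnesses that block [y] is not below block [x]; the bound by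
   [g 0] lets [u] be realized without using a given participant of each block. *)
Definition separates (u : J -> nat) (x y : J) : Prop :=
  [/\ forall z, u z <= g 0,
      exists v X, [/\ X \in Delta, basis_vector h X v
                    & forall z, v z <= u z + (z == y)]
    & forall v X, X \in Delta -> basis_vector h X v ->
        ~ forall z, v z <= u z + (z == x)].

Lemma separates_base (X : {set J}) v x y :
  X \in Delta -> basis_vector h X v ->
  (forall w Z, Z \in Delta -> basis_vector h Z w ->
    ~ forall z, w z <= v z - (z == y) + (z == x)) ->
  separates (fun z => v z - (z == y)) x y.
Proof.
move=> XD bv nG; split=> //; last by exists v, X; split=> // z; lia.
by move=> z; apply: leq_trans (leq_subr _ _) (basis_le z bv).
Qed.

Lemma sum_sub1 (v : J -> nat) (T : {set J}) y :
  \sum_(z in T) (v z - (z == y)) <= \sum_(z in T) v z.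
Proof. by apply: leq_sum => z _; apply: leq_subr. Qed.

Lemma sum_sub1_lt (v : J -> nat) (T : {set J}) y : y \in T -> 0 < v y ->
  \sum_(z in T) (v z - (z == y)) < \sum_(z in T) v z.
Proof.
move=> yT vy; rewrite (big_setD1 y) //= [ltnRHS](big_setD1 y) //= eqxx.
by have := sum_sub1 v (T :\ y) y; lia.
Qed.

(** Only sets avoiding [y] need the hypothesis on weights: a set containing [y] becomes too light
    once the unit at [y] is removed. *)
Lemma separates_notin (X : {set J}) v x y :
  X \in Delta -> x \notin X -> y \in X -> basis_vector h X v ->
  (forall T : {set J}, T \in Delta -> T \subset X :\ y ->
     \sum_(z in T) v z < h T) ->
  exists u, separates u x y.
Proof.
move=> XD xX yX bv small.
have vX z : z \notin X -> v z = 0.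
  by case: bv => /subsetP sv _ _; apply: contraNeq => vz; apply: sv; rewrite inE.
have small' (T : {set J}) : T \in Delta -> T \subset X ->
    \sum_(z in T) (v z - (z == y)) < h T.
  move=> TD TX; have [yT|yT] := boolP (y \in T).
    apply: leq_trans (basis_sum_le bv TX); apply: sum_sub1_lt => //.
    exact: leq_trans (incr_card_gt0 yX) (basis_ge bv yX).
  by apply: leq_ltn_trans (sum_sub1 _ _ _) (small _ TD _); rewrite subsetD1 TX.
have ltXJ : #|X| < #|J| by have := max_card (x |: X); rewrite cardsU1 xX.
exists (fun z => v z - (z == y)); apply: (separates_base XD bv) => w Z ZD bw hw.
have wsum := basis_sum bw.
have hw' (T : {set J}) : x \notin T ->
    \sum_(z in T) w z <= \sum_(z in T) (v z - (z == y)).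
  move=> xT; apply: leq_sum => z zT; have := hw z.
  by have [zx|_] := eqVneq z x; [rewrite -zx zT in xT | rewrite addn0].
(* Positivity of the increments gives [w] a positive entry everywhere on [Z], whereas the profile
   vanishes outside [x |: X]. *)
have sZX : Z :\ x \subset X.
  apply/subsetP => z /setD1P[zx zZ]; apply: contraT => zX.
  have := hw z; rewrite (vX _ zX) (negbTE zx) sub0n.
  suff : 0 < w z by lia.
  exact: leq_trans (incr_card_gt0 zZ) (basis_ge bw zZ).
have [xZ|xZ] := boolP (x \in Z); last first.
  have /setDidPl Zx : [disjoint Z & [set x]] by rewrite disjoint_sym disjoints1.
  rewrite Zx in sZX.
  by have := small' _ ZD sZX; have := hw' _ xZ; lia.
(* With [x] in [Z], its entry is the single added unit, so the last increment of [Z] is 1 and [w]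
   has weight at least [h (Z :\ x)] on [Z :\ x]. *)
have wx : w x <= 1 by have := hw x; rewrite (vX _ xX) eqxx sub0n.
have gx := basis_ge bw xZ; have gx0 := incr_card_gt0 xZ; move: (wsum).
rewrite (big_setD1 x) //= (rankD1 xZ) => wsum'.
have [TD|TD] := boolP (Z :\ x \in Delta).
  have := small' _ TD sZX; have := hw' (Z :\ x).
  by rewrite setD11 => /(_ isT); lia.
(* Now [X] and [Z] meet outside [Delta], and the strict inequality reduces to [g #|X| < 1]. *)
have XZ : X :&: Z = Z :\ x.
  apply/setP => z; rewrite !inE; have [->|zx] := eqVneq z x; first by rewrite (negbTE xX).
  by rewrite andbC; case zZ: (z \in Z) => //=; apply: (subsetP sZX); rewrite !inE zx.
have XuZ : X :|: Z = x |: X.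
  by rewrite -(setD1K xZ) setUCA (setUidPl sZX).
have := compatible_strict XD ZD; rewrite XZ XuZ rankU1 // (rankD1 xZ) => /(_ TD).
by have := incr_gt0 ltXJ; lia.
Qed.

Lemma separates_singleton (M : {set J}) x y : x != y ->
  [set x] \in Delta -> M \in min_family Delta -> x \notin M ->
  exists u, separates u x y.
Proof.
move=> xy xD; rewrite inE => /minsetP[MD Mmin] xM.
(* Listing [y] first gives it the value [g 0]. *)
set s := y :: enum (M :\ y).
have us : uniq s by rewrite /= mem_enum setD11 enum_uniq.
have sE : [set:: s] = y |: M.
  by apply/setP => z; rewrite !inE mem_enum !inE; case: (z == y).
have bv := greedy_basis us; rewrite sE in bv.
apply: (separates_notin _ _ (setU11 y M) bv).
- by case: hDelta => _ _ /(_ _ _ MD); apply; apply: subsetUr.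
- by rewrite !inE negb_or xy.
move=> T TD; rewrite subsetD1 => /andP[TyM yT].
have TM : T \subset M.
  by apply/subsetP => z zT; case/setU1P: (subsetP TyM _ zT) => // zy; rewrite -zy zT in yT.
have ?:= Mmin _ TD TM; subst T.
have := basis_sum bv; rewrite big_setU1 //= rankU1 // ffunE mem_head /= eqxx.
(* By minimality only [M] itself is left to check. Compatibility with [[set x]] yields
   [g #|M| < g 0], so the weight [h M + g #|M| - g 0] on [M] falls short of [h M]. *)
have xM0 : [set x] :&: M = set0 by apply/eqP; rewrite setI_eq0 disjoints1.
have := compatible_strict xD MD; rewrite xM0 rank1 rankU1 //.
by case: hDelta => _ -> _ /(_ isT); case: hZ => -[-> _ _] _ _; lia.
Qed.

(** Grow [Z] from [[set x]]. If two different one-point extensions of [Z] both entered [Delta],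
    compatibility would force a strict drop between consecutive increments that are both [g 1]. *)
Lemma ex_nonmember (x y : J) j : x != y -> [set x] \notin Delta ->
  j.+1 < #|J| -> (forall k, 0 < k <= j -> g k = g 1) ->
  forall k, k < j ->
  exists Z : {set J}, [/\ #|Z| = k.+1, x \in Z, y \notin Z & Z \notin Delta].
Proof.
move=> xy xD jJ gj; elim=> [|k IH] kj.
  by exists [set x]; rewrite cards1 set11 inE eq_sym.
have [Z [cZ xZ yZ ZD]] := IH (ltnW kj).
have : 1 < #|~: (y |: Z)|.
  by have := cardsC (y |: Z); rewrite cardsU1 yZ cZ; lia.
case/card_gt1P => a [b [aZ bZ ab]].
move: aZ bZ; rewrite !inE !negb_or => /andP[ay aZ] /andP[b_y bZ].
have [aD|aD] := boolP (a |: Z \in Delta); last first.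
  exists (a |: Z); split; rewrite ?cardsU1 ?aZ ?cZ // !inE ?xZ ?orbT //.
  by rewrite negb_or yZ eq_sym ay.
have [bD|bD] := boolP (b |: Z \in Delta); last first.
  exists (b |: Z); split; rewrite ?cardsU1 ?bZ ?cZ // !inE ?xZ ?orbT //.
  by rewrite negb_or yZ eq_sym b_y.
have := compatible_strict aD bD.
rewrite setI_setU1 // setU_setU1 => /(_ ZD).
rewrite !rankU1 ?inE ?negb_or 1?eq_sym ?ab // cardsU1 aZ cZ add1n.
by rewrite (gj k.+1) ?(gj k.+2); lia.
Qed.

Lemma separates_full (x y : J) : 1 < #|J| -> x != y -> [set x] \notin Delta ->
  g (#|J| - 1) < g 1 -> exists u, separates u x y.
Proof.
move=> J1 xy xD g1.
have J2 : 1 < #|J| - 1.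
  rewrite ltn_neqAle subn_gt0 J1 andbT; apply/eqP => J2.
  by rewrite -J2 ltnn in g1.
(* The least such [i] marks the first drop below [g 1]; the nonmember [Z0] will have size [i.-1]. *)
have exi : exists i, (1 < i) && (g i < g 1).
  by exists (#|J| - 1); rewrite g1 J2.
have [i /andP[i1 gi] imin] := ex_minnP exi.
have iJ : i < #|J|.
  apply: leq_ltn_trans (imin (#|J| - 1) _) _; last by lia.
  by rewrite g1 J2.
have gj k : 0 < k <= i.-1 -> g k = g 1.
  move=> /andP[k0 ki]; have gk1 : g k <= g 1 by apply: incr_antitone; lia.
  apply/eqP; rewrite eqn_leq gk1 /=.
  rewrite leqNgt; apply/negP => gk.
  have k1 : 1 < k by case: k k0 gk {ki gk1} => [|[|]] //; rewrite ltnn.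
  by have := imin k; rewrite k1 gk => /(_ isT); lia.
have [] := @ex_nonmember x y i.-1 xy xD _ gj i.-2; [by lia..|].
move=> Z0 [cZ0 xZ0 yZ0 Z0D].
set e1 := enum (Z0 :\ x); set e2 := enum (~: (y |: Z0)).
(* The elements of [y |: Z0] fill the first [i] positions, so every other element gets at most
   [g i], which is below [g 1]. *)
set s := x :: y :: e1 ++ e2.
have us : uniq s.
  rewrite /= inE negb_or xy !mem_cat !mem_enum !inE !eqxx (negbTE xy) xZ0 (negbTE yZ0) andbF /=.
  rewrite cat_uniq !enum_uniq /= andbT; apply/hasPn => z; rewrite !mem_enum !inE.
  by rewrite negb_or => /andP[_ /negbTE ->]; rewrite andbF.
have sT : [set:: s] = setT.
  apply/setP => z; rewrite !inE mem_cat !mem_enum !inE.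
  by case: (z == x); case: (z == y); case: (z \in Z0).
have size_s : size s = #|J| by rewrite -(card_uniqP us) -cardsE sT cardsT.
have bv := greedy_basis us; rewrite sT in bv; set v := greedy s in bv.
have vx : v x = g 0 by rewrite ffunE mem_head /= eqxx.
have vy : v y = g 1 by rewrite ffunE !inE eqxx orbT /= (negbTE xy) eqxx.
have vsmall z : z != y -> z \notin Z0 -> v z < g 1.
  move=> zy zZ0; have zx : z != x by apply: contraNneq zZ0 => ->.
  have zs : z \in s by have := in_setT z; rewrite -sT inE.
  apply: leq_ltn_trans gi; rewrite ffunE zs; apply: incr_antitone.
    rewrite /= eq_sym (negbTE zx) eq_sym (negbTE zy) index_cat mem_enum !inE (negbTE zZ0) andbF.
    by have := cardsD1 x Z0; rewrite xZ0 cZ0 -cardE; lia.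
  by rewrite -size_s ltnW // index_mem.
have TD : setT \in Delta.
  case: hDelta => /set0Pn[X XD] _ up; exact: up XD (subsetT X).
exists (fun z => v z - (z == y)); apply: (separates_base TD bv) => w Z ZD bw hw.
have wsum := basis_sum bw.
have le_w : \sum_(z in Z) w z <= \sum_(z in Z) (v z - (z == y)).
  (* The added unit at [x] is lost: [w x] cannot exceed [g 0], which [v x] already attains. *)
  apply: leq_sum => z _; have := hw z; have [->|_] := eqVneq z x; last by rewrite addn0.
  by rewrite (negbTE xy) subn0 vx (basis_le x bw).
have le_v T := basis_sum_le bv (subsetT T).
have [yZ|yZ] := boolP (y \in Z).
  have vy0 : 0 < v y by rewrite vy; lia.
  by have := sum_sub1_lt yZ vy0; have := le_v Z; lia.
have /subsetPn[z zZ zZ0] : ~~ (Z \subset Z0).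
  by apply: contra Z0D; case: hDelta => _ _ up; apply: up ZD.
have zy : z != y by apply: contraNneq yZ => <-.
have yZz : y \notin Z :\ z by rewrite !inE negb_and yZ orbT.
(* Exchanging [z] for [y] keeps the rank by uniformity but raises the weight of [v], since
   [v z < g 1 = v y]. Hence [v] weighs strictly less than [h Z] on [Z]. *)
have := le_v (y |: (Z :\ z)); rewrite big_setU1 //= vy.
have -> : h (y |: (Z :\ z)) = h Z.
  by case: hZ => _ + _; apply; rewrite cardsU1 yZz (cardsD1 z Z) zZ.
have := leq_trans le_w (sum_sub1 v Z y); rewrite wsum (big_setD1 z) //=.
by have := vsmall _ zy zZ0; lia.
Qed.

Lemma ex_separates (x y : J) : 1 < #|J| -> x != y ->
  g (#|J| - 1) < g 1 -> min_family Delta != [set [set x]] ->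
  exists u, separates u x y.
Proof.
move=> J1 xy g1 minx; have [xD|xD] := boolP ([set x] \in Delta); last first.
  exact: separates_full.
have xmin : [set x] \in min_family Delta.
  rewrite inE; apply/minsetP; split=> // B BD.
  rewrite subset1 => /orP[/eqP //|/eqP B0].
  by case: hDelta => _ /negP[]; rewrite -B0.
have [M Mmin MNx] : exists2 M, M \in min_family Delta & M != [set x].
  apply/exists_inP; apply: contraR minx; rewrite negb_exists_in => /forall_inP all1.
  apply/eqP/setP => M; apply/idP/set1P => [|-> //].
  by move/all1; rewrite negbK => /eqP.
apply: (separates_singleton xy xD Mmin); apply: contra MNx => xM.
move: Mmin; rewrite inE => /minsetP[_ /(_ _ xD)].
by rewrite sub1set => /(_ xM) ->.
Qed.

End Ports.
End UniformPolymatroid.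

(** * From profiles to sets of participants *)

Lemma ex_subset_card (T : finType) (B : {set T}) n :
  n <= #|B| -> exists2 C : {set T}, C \subset B & #|C| = n.
Proof.
case/card_geqP => s [us ss /subsetP sB].
exists [set:: s]; last by rewrite cardsE (card_uniqP us).
by apply/subsetP => z; rewrite inE; apply: (subsetP sB).
Qed.

Lemma ex_profile (J P : finType) (Pi : J -> {set P}) (F : {set P}) (u : J -> nat) :
  block_partition Pi -> (forall z, u z <= #|Pi z :\: F|) ->
  exists2 A : {set P}, A \subset ~: F & forall z, #|A :&: Pi z| = u z.
Proof.
case=> _ dis _ uF.
have /fin_all_exists2[C sC cC] z := ex_subset_card (uF z).
exists (\bigcup_z C z).
  apply/bigcupsP => z _; apply: subset_trans (sC z) _.
  by rewrite setDE subsetIr.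
move=> z; rewrite -(cC z); congr #|pred_of_set _|; apply/setP => t; rewrite inE.
apply/andP/idP => [[/bigcupP[z' _ tz'] tz]|tz].
  have [<- //|zz'] := eqVneq z' z.
  have /subsetP/(_ _ tz') := sC z'; rewrite inE => /andP[_ tPz'].
  by have := disjointFr (dis _ _ zz') tPz'; rewrite tz.
split; first by apply/bigcupP; exists z.
by have /subsetP/(_ _ tz) := sC z; rewrite inE => /andP[].
Qed.

Lemma profile_setU1 (J P : finType) (Pi : J -> {set P}) (A : {set P}) x p z :
  block_partition Pi -> p \in Pi x -> p \notin A ->
  profile Pi (p |: A) z = #|A :&: Pi z| + (z == x).
Proof.
move=> [_ dis _] px pA; rewrite ffunE setIUl.
have [->|zx] := eqVneq z x.
  rewrite (setIidPl _) ?sub1set // cardsU1 inE (negbTE pA) addnC //.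
have /eqP -> : [set p] :&: Pi z == set0.
  by rewrite setI_eq0 disjoints1 (disjointFl (dis _ _ zx)).
by rewrite set0U addn0.
Qed.

Lemma separates_block_le (J P : finType) (Pi : J -> {set P}) h g Delta u x y :
  block_partition Pi -> x != y -> (forall z, g 0 < #|Pi z|) ->
  separates h g Delta u x y ->
  ~ block_le (access_structure Pi h Delta) (Pi y) (Pi x).
Proof.
move=> hPi xy gP [ug [v [X [XD bv vu]]] nG] [q [p [qy px le_qp]]].
have uF z : u z <= #|Pi z :\: [set p; q]|.
  (* As [p] and [q] lie in different blocks, each block loses at most one participant, which the
     strict bound [g 0 < #|Pi z|] allows. *)
  suff : #|Pi z :&: [set p; q]| <= 1.
    by have := cardsID [set p; q] (Pi z); have := ug z; have := gP z; lia.
  have [_ dis _] := hPi.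
  have [zx|zx] := eqVneq z x; rewrite -(cards1 (if z == x then p else q)).
    rewrite zx eqxx; apply/subset_leq_card/subsetP => t; rewrite !inE => /andP[tx].
    by case/orP=> // /eqP tq; move: tx; rewrite tq (disjointFl (dis _ _ xy)).
  rewrite (negbTE zx); apply/subset_leq_card/subsetP => t; rewrite !inE => /andP[tz].
  by case/orP=> // /eqP tp; move: tz; rewrite tp (disjointFl (dis _ _ zx)).
have [A sA cA] := ex_profile hPi uF.
have pA : p \notin A by apply: contraTN sA => pA; apply/subsetPn; exists p; rewrite ?inE ?eqxx.
have qA : q \notin A by apply: contraTN sA => qA; apply/subsetPn; exists q; rewrite ?inE ?eqxx ?orbT.
have [|w [Z [ZD bw wu]]] := le_qp A sA.
  by exists v, X; split=> // z; rewrite (profile_setU1 _ hPi qy) // cA.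
by apply: (nG w Z ZD bw) => z; have := wu z; rewrite (profile_setU1 _ hPi px) // cA.
Qed.

Theorem theorem4p2 (J P : finType) (Pi : J -> {set P})
    (h : {set J} -> nat) (g : nat -> nat) (Delta : {set {set J}})
    (hm : 3 <= #|J|)
    (hPi : block_partition Pi)
    (hZ : uniform_polymatroid h g)
    (hg0 : 0 < g 0)
    (hg0P : forall x : J, g 0 < #|Pi x|)
    (hDelta : monotone_family Delta)
    (hcomp : compatible h Delta)
    (hg1 : g 1 > g (#|J| - 1))
    (hgm : g (#|J| - 1) > 0)
    (hmin : forall x : J, min_family Delta != [set [set x]]) :
  compartmented Pi (access_structure Pi h Delta).
Proof.
suff indep x y : x != y ->
    ~ block_le (access_structure Pi h Delta) (Pi y) (Pi x).
  move=> x y Pxy; have xy : x != y by apply: contraNneq Pxy => ->.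
  by split; apply: indep; rewrite // eq_sym.
move=> xy.
have [u su] := ex_separates hZ hDelta hcomp hgm (ltnW hm) xy hg1 (hmin x).
exact: separates_block_le hPi xy hg0P su.
Qed.
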